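(* Let $(F,A)_{(Q,\cdot)}$ be a distributive soft quasigroup. Then: (1) its five parastrophes $(F,A)_{(Q,\circledast)}$, $(F,A)_{(Q,\backslash)}$, $(F,A)_{(Q,/)}$, $(F,A)_{(Q,\backslash\backslash)}$, $(F,A)_{(Q,//)}$ are distributive soft quasigroups; (2) $(F,A)_{(Q,\cdot)}$, $(F,A)_{(Q,\circledast)}$, $(F,A)_{(Q,\backslash)}$, $(F,A)_{(Q,/)}$, $(F,A)_{(Q,\backslash\backslash)}$, $(F,A)_{(Q,//)}$ are idempotent soft quasigroups; (3) $(F,A)_{(Q,\cdot)}$, $(F,A)_{(Q,\circledast)}$, $(F,A)_{(Q,\backslash)}$, $(F,A)_{(Q,/)}$, $(F,A)_{(Q,\backslash\backslash)}$, $(F,A)_{(Q,//)}$ are flexible soft quasigroups.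
   Context: A quasigroup is a nonempty set $Q$ with a binary operation $\cdot$ such that for all $a,b\in Q$ each of the equations $a\cdot x=b$ and $y\cdot a=b$ has a unique solution in $Q$. A nonempty subset $H\subseteq Q$ is a subquasigroup if it is closed under the operation and is a quasigroup under the restricted operation. The five parastrophes of a quasigroup $(Q,\cdot)$ are the quasigroups on $Q$ with operations defined by: $x\backslash y=z\Leftrightarrow x\cdot z=y$; $x/y=z\Leftrightarrow z\cdot y=x$; $y\circledast x=z\Leftrightarrow x\cdot y=z$; $x//y=z\Leftrightarrow y/x=z\Leftrightarrow z\cdot x=y$; $x\backslash\backslash y=z\Leftrightarrow y\backslash x=z\Leftrightarrow y\cdot z=x$. A quasigroup $(Q,\ast)$ is distributive if $x\ast(y\ast z)=(x\ast y)\ast(x\ast z)$ and $(y\ast z)\ast x=(y\ast x)\ast(z\ast x)$ for all $x,y,z\in Q$; idempotent if $x\ast x=x$ for all $x$; flexible if $x\ast(y\ast x)=(x\ast y)\ast x$ for all $x,y$. A soft set $(F,A)$ over $Q$ consists of a set $A$ of parameters and a map $F:A\to 2^{Q}\setminus\{\emptyset\}$. For a quasigroup operation $\ast$ on $Q$, $(F,A)_{(Q,\ast)}$ denotes this soft set regarded over $(Q,\ast)$; it is a soft quasigroup if $F(a)$ is a subquasigroup of $(Q,\ast)$ for all $a\in A$. A soft quasigroup $(F,A)_{(Q,\ast)}$ is called distributive (idempotent, flexible) if the quasigroup $(Q,\ast)$ is distributive (idempotent, flexible). The parastrophes of $(F,A)_{(Q,\cdot)}$ are the soft sets $(F,A)_{(Q,\ast)}$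 with $\ast$ ranging over the five parastrophic operations above. *)

(* Defs.v *)
From Stdlib Require Import ClassicalEpsilon Ensembles.

Set Implicit Arguments.

Definition binop (Q : Type) : Type := Q -> Q -> Q.

Definition quasigroup (Q : Type) (op : binop Q) : Prop :=
  inhabited Q /\
  (forall a b : Q, exists! x : Q, op a x = b) /\
  (forall a b : Q, exists! y : Q, op y a = b).

Definition closed_under (Q : Type) (op : binop Q) (H : Ensemble Q) : Prop :=
  forall x y : Q, In Q H x -> In Q H y -> In Q H (op x y).

Definition restrict (Q : Type) (op : binop Q) (H : Ensemble Q)
    (Hcl : closed_under op H) : binop {x : Q | In Q H x} :=
  fun u v => exist _ (op (proj1_sig u) (proj1_sig v))
                     (Hcl _ _ (proj2_sig u) (proj2_sig v)).

(* Nonemptiness of H is the [inhabited] clause of [quasigroup]. *)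
Definition subquasigroup (Q : Type) (op : binop Q) (H : Ensemble Q) : Prop :=
  exists Hcl : closed_under op H, quasigroup (restrict Hcl).

(* The two divisions are total functions of an arbitrary operation; they are
   meaningful when the equations they solve have unique solutions, see
   [ldivP] and [rdivP] below. *)

(* x \ y *)
Definition ldiv (Q : Type) (op : binop Q) : binop Q :=
  fun x y => epsilon (inhabits x) (fun z => op x z = y).

(* x / y *)
Definition rdiv (Q : Type) (op : binop Q) : binop Q :=
  fun x y => epsilon (inhabits x) (fun z => op z y = x).

(* The circled-star parastrophe of [op]. *)
Definition opposite (Q : Type) (op : binop Q) : binop Q :=
  fun y x => op x y.

(* x // y = y / x *)
Definition rdiv_opp (Q : Type) (op : binop Q) : binop Q :=
  fun x y => rdiv op y x.

(* x \\ y = y \ x *)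
Definition ldiv_opp (Q : Type) (op : binop Q) : binop Q :=
  fun x y => ldiv op y x.

Lemma ldivP (Q : Type) (op : binop Q) (hq : quasigroup op) (x y z : Q) :
  ldiv op x y = z <-> op x z = y.
Proof.
  destruct hq as [_ [hl _]]; destruct (hl x y) as [w [hw uw]].
  assert (e : op x (ldiv op x y) = y)
    by (apply (epsilon_spec (inhabits x) (fun z => op x z = y)); now exists w).
  split; intro h.
  - now rewrite <- h.
  - now rewrite <- (uw _ e), <- (uw _ h).
Qed.

Lemma rdivP (Q : Type) (op : binop Q) (hq : quasigroup op) (x y z : Q) :
  rdiv op x y = z <-> op z y = x.
Proof.
  destruct hq as [_ [_ hr]]; destruct (hr y x) as [w [hw uw]].
  assert (e : op (rdiv op x y) y = x)
    by (apply (epsilon_spec (inhabits x) (fun z => op z y = x)); now exists w).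
  split; intro h.
  - now rewrite <- h.
  - now rewrite <- (uw _ e), <- (uw _ h).
Qed.

Definition distributive (Q : Type) (op : binop Q) : Prop :=
  (forall x y z : Q, op x (op y z) = op (op x y) (op x z)) /\
  (forall x y z : Q, op (op y z) x = op (op y x) (op z x)).

Definition idempotent (Q : Type) (op : binop Q) : Prop :=
  forall x : Q, op x x = x.

Definition flexible (Q : Type) (op : binop Q) : Prop :=
  forall x y : Q, op x (op y x) = op (op x y) x.

Record soft_set (A Q : Type) : Type := SoftSet {
  soft_map :> A -> Ensemble Q;
  soft_map_nonempty : forall a : A, Inhabited Q (soft_map a)
}.

Definition soft_quasigroup (A Q : Type) (F : soft_set A Q) (op : binop Q) : Prop :=
  quasigroup op /\ forall a : A, subquasigroup op (F a).

Definition distributive_soft_quasigroup (A Q : Type) (F : soft_set A Q)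
    (op : binop Q) : Prop :=
  soft_quasigroup F op /\ distributive op.

Definition idempotent_soft_quasigroup (A Q : Type) (F : soft_set A Q)
    (op : binop Q) : Prop :=
  soft_quasigroup F op /\ idempotent op.

Definition flexible_soft_quasigroup (A Q : Type) (F : soft_set A Q)
    (op : binop Q) : Prop :=
  soft_quasigroup F op /\ flexible op.

(* Main.v *)
Require Import Defs.
From Stdlib Require Import Ensembles ProofIrrelevance.

Set Implicit Arguments.

(** Two constructions generate all the parastrophes of an operation: taking the
    opposite, and replacing [op] by its left division [\], the operation with
    [x \ y = z <-> x * z = y].  Indeed [//] is the left division of the
    opposite of [op], while [\\] and [/] are the opposites of [\] and [//].
    So it suffices that each of the two constructions preserves distributive
    soft quasigroups; idempotency and flexibility then follow for every
    parastrophe, since distributive quasigroups have both properties.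

    Subquasigroups pass to left divisions because the restriction of a left
    division is the left division of the restriction.  The only deep point is
    that [\] is right distributive.  It amounts to the instance
    [(y * p) * (w * t) = (y * w) * (p * t)] of the medial law for
    [y * p = w * t] ([medial_of_equal_products]).  In a distributive quasigroup
    all translations are endomorphisms, hence so are both sides of the medial
    law [(y * b) * (w * t) = (y * w) * (b * t)] as functions of [b].  They
    agree at [y], [w] and [t], so they agree on every element that these three
    generate by products and divisions, and in particular at [p], the left
    quotient of [w * t] by [y]. *)

(** * Consequences of distributivity *)

Lemma quasigroup_cancel_l (Q : Type) (op : binop Q) (hq : quasigroup op) (a x y : Q) :
  op a x = op a y -> x = y.
Proof.
  intro e; destruct hq as [_ [hl _]].
  destruct (hl a (op a y)) as [z [_ uz]].
  now rewrite <- (uz x e), <- (uz y eq_refl).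
Qed.

Lemma quasigroup_cancel_r (Q : Type) (op : binop Q) (hq : quasigroup op) (a x y : Q) :
  op x a = op y a -> x = y.
Proof.
  intro e; destruct hq as [_ [_ hr]].
  destruct (hr a (op y a)) as [z [_ uz]].
  now rewrite <- (uz x e), <- (uz y eq_refl).
Qed.

(** Left distributivity gives [a (a a) = (a a) (a a)], where [a a] cancels on
    the right. *)
Lemma distributive_idempotent (Q : Type) (op : binop Q) :
  quasigroup op -> distributive op -> idempotent op.
Proof.
  intros hq [dl _] a; symmetry.
  apply (quasigroup_cancel_r hq (op a a)), dl.
Qed.

Lemma distributive_flexible (Q : Type) (op : binop Q) :
  distributive op -> idempotent op -> flexible op.
Proof.
  intros [dl _] id x y.
  now rewrite dl, id.
Qed.

Definition endomorphism (Q : Type) (op : binop Q) (f : Q -> Q) : Prop :=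
  forall a b : Q, f (op a b) = op (f a) (f b).

Lemma endomorphisms_agree_ldiv (Q : Type) (op : binop Q) (f g : Q -> Q) (a b : Q) :
  quasigroup op -> endomorphism op f -> endomorphism op g ->
  f a = g a -> f (op a b) = g (op a b) -> f b = g b.
Proof.
  intros hq hf hg ea eab.
  apply (quasigroup_cancel_l hq (f a)).
  now rewrite <- hf, eab, hg, ea.
Qed.

(** Both sides of the medial law are composites of translations in [b], and
    translations of a distributive operation are endomorphisms. *)
Lemma medial_sides_endomorphisms (Q : Type) (op : binop Q) (y w t : Q) :
  distributive op ->
  endomorphism op (fun b => op (op y b) (op w t)) /\
  endomorphism op (fun b => op (op y w) (op b t)).
Proof.
  intros [dl dr]; split; intros a b.
  - now rewrite (dl y a b), dr.
  - now rewrite (dr t a b), dl.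
Qed.

Lemma medial_of_equal_products (Q : Type) (op : binop Q) (y p w t : Q) :
  quasigroup op -> distributive op -> op y p = op w t ->
  op (op y p) (op w t) = op (op y w) (op p t).
Proof.
  intros hq hd e.
  pose proof (distributive_idempotent hq hd) as id.
  destruct (medial_sides_endomorphisms y w t hd) as [hf hg].
  destruct hd as [dl dr].
  apply (endomorphisms_agree_ldiv y p hq hf hg); simpl.
  - now rewrite (id y), dl.
  - (* [y * p] is the product of [w] and [t], where the two maps agree *)
    rewrite e; transitivity (op (op (op y w) (op w t)) (op (op y t) (op w t))).
    + apply hf.
    + now rewrite (hg w t), <- (dr t y w), (id t).
Qed.

(** * Passage to the opposite and to the left division *)

(** Stated as a relation rather than by means of [ldiv], so that it applies to
    [rdiv_opp op] over [opposite op] and to restrictions, where the operation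
    at hand is not an [ldiv] by definition. *)
Definition left_division_of (Q : Type) (op op' : binop Q) : Prop :=
  forall x y z : Q, op' x y = z <-> op x z = y.

Lemma left_division_spec (Q : Type) (op op' : binop Q) (x y : Q) :
  left_division_of op op' -> op x (op' x y) = y.
Proof. intro hd; now apply hd. Qed.

Lemma quasigroup_opposite (Q : Type) (op : binop Q) :
  quasigroup op -> quasigroup (opposite op).
Proof. now intros [hi [hl hr]]. Qed.

Lemma quasigroup_left_division (Q : Type) (op op' : binop Q) :
  left_division_of op op' -> quasigroup op -> quasigroup op'.
Proof.
  intros hd [hi [_ hr]]; split; [exact hi | split]; intros a b.
  - exists (op a b); split; [now apply hd |].
    intros x hx; now apply hd.
  - destruct (hr b a) as [y [hy uy]].
    exists y; split; [now apply hd |].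
    intros z hz; now apply uy, hd.
Qed.

Lemma subquasigroup_opposite (Q : Type) (op : binop Q) (H : Ensemble Q) :
  subquasigroup op H -> subquasigroup (opposite op) H.
Proof.
  intros [hcl hq].
  exists (fun x y hx hy => hcl y x hy hx).
  exact (quasigroup_opposite hq).
Qed.

Lemma closed_under_left_division (Q : Type) (op op' : binop Q) (H : Ensemble Q) :
  left_division_of op op' -> subquasigroup op H -> closed_under op' H.
Proof.
  intros hd [hcl [_ [hl _]]] x y hx hy.
  destruct (hl (exist _ x hx) (exist _ y hy)) as [[z hz] [e _]].
  apply (f_equal (@proj1_sig _ _)) in e; simpl in e.
  now rewrite (proj2 (hd x y z) e).
Qed.

Lemma left_division_restrict (Q : Type) (op op' : binop Q) (H : Ensemble Q)
    (hcl : closed_under op H) (hcl' : closed_under op' H) :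
  left_division_of op op' -> left_division_of (restrict hcl) (restrict hcl').
Proof.
  intros hd [x hx] [y hy] [z hz]; split; intro e;
    apply (f_equal (@proj1_sig _ _)) in e; simpl in e;
    apply subset_eq_compat; now apply hd.
Qed.

Lemma subquasigroup_left_division (Q : Type) (op op' : binop Q) (H : Ensemble Q) :
  left_division_of op op' -> subquasigroup op H -> subquasigroup op' H.
Proof.
  intros hd hs; exists (closed_under_left_division hd hs).
  destruct hs as [hcl hq].
  exact (quasigroup_left_division (left_division_restrict hcl _ hd) hq).
Qed.

Lemma distributive_opposite (Q : Type) (op : binop Q) :
  distributive op -> distributive (opposite op).
Proof. intros [dl dr]; split; unfold opposite; auto. Qed.

(** Write [x \ y] for [op' x y].  Left distributivity says that the left
    translations of [op] are automorphisms, hence so are their inverses, the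
    left translations of [\].  Right distributivity becomes
    [z * (p * t) = x] for [p = y \ x] and [t = w \ x], where [w = y \ z], so
    that [z = y * w] and [y * p = x = w * t]: the medial law gives
    [z * (p * t) = x * x]. *)
Lemma distributive_left_division (Q : Type) (op op' : binop Q) :
  left_division_of op op' -> quasigroup op -> distributive op ->
  distributive op'.
Proof.
  intros hd hq hdist.
  pose proof (fun x y => left_division_spec x y hd) as spec.
  split; intros x y z; symmetry.
  - apply hd, (quasigroup_cancel_l hq x).
    rewrite (proj1 hdist).
    now rewrite !spec.
  - apply hd; symmetry; apply hd.
    set (w := op' y z).
    assert (e : op y (op' y x) = op w (op' w x)) by now rewrite !spec.
    rewrite <- (spec y z) at 1; fold w.
    rewrite <- (medial_of_equal_products _ _ _ _ hq hdist e), !spec.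
    now apply distributive_idempotent.
Qed.

(** * Distributive soft quasigroups *)

Lemma distributive_soft_quasigroup_opposite (A Q : Type) (F : soft_set A Q)
    (op : binop Q) :
  distributive_soft_quasigroup F op ->
  distributive_soft_quasigroup F (opposite op).
Proof.
  intros [[hq hs] hd]; split; [split |].
  - now apply quasigroup_opposite.
  - intro a; now apply subquasigroup_opposite.
  - now apply distributive_opposite.
Qed.

Lemma distributive_soft_quasigroup_left_division (A Q : Type) (F : soft_set A Q)
    (op op' : binop Q) :
  left_division_of op op' -> distributive_soft_quasigroup F op ->
  distributive_soft_quasigroup F op'.
Proof.
  intros h [[hq hs] hd]; split; [split |].
  - exact (quasigroup_left_division h hq).
  - intro a; exact (subquasigroup_left_division h (hs a)).
  - exact (distributive_left_division h hq hd).
Qed.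

Lemma distributive_soft_quasigroup_idempotent (A Q : Type) (F : soft_set A Q)
    (op : binop Q) :
  distributive_soft_quasigroup F op -> idempotent_soft_quasigroup F op.
Proof.
  intros [hs hd]; split; [exact hs |].
  exact (distributive_idempotent (proj1 hs) hd).
Qed.

Lemma distributive_soft_quasigroup_flexible (A Q : Type) (F : soft_set A Q)
    (op : binop Q) :
  distributive_soft_quasigroup F op -> flexible_soft_quasigroup F op.
Proof.
  intros [hs hd]; split; [exact hs |].
  exact (distributive_flexible hd (distributive_idempotent (proj1 hs) hd)).
Qed.

Unset Implicit Arguments.

Theorem theorem3p3 (Q A : Type) (op : binop Q) (F : soft_set A Q)
    (hF : distributive_soft_quasigroup F op) :
  (distributive_soft_quasigroup F (opposite op) /\
   distributive_soft_quasigroup F (ldiv op) /\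
   distributive_soft_quasigroup F (rdiv op) /\
   distributive_soft_quasigroup F (ldiv_opp op) /\
   distributive_soft_quasigroup F (rdiv_opp op)) /\
  (idempotent_soft_quasigroup F op /\
   idempotent_soft_quasigroup F (opposite op) /\
   idempotent_soft_quasigroup F (ldiv op) /\
   idempotent_soft_quasigroup F (rdiv op) /\
   idempotent_soft_quasigroup F (ldiv_opp op) /\
   idempotent_soft_quasigroup F (rdiv_opp op)) /\
  (flexible_soft_quasigroup F op /\
   flexible_soft_quasigroup F (opposite op) /\
   flexible_soft_quasigroup F (ldiv op) /\
   flexible_soft_quasigroup F (rdiv op) /\
   flexible_soft_quasigroup F (ldiv_opp op) /\
   flexible_soft_quasigroup F (rdiv_opp op)).
Proof.
  pose proof (proj1 (proj1 hF)) as hq.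
  pose proof (distributive_soft_quasigroup_opposite hF) as hopp.
  assert (hldiv : distributive_soft_quasigroup F (ldiv op)).
  { refine (distributive_soft_quasigroup_left_division _ hF).
    intros x y z; exact (ldivP hq x y z). }
  assert (hrdiv_opp : distributive_soft_quasigroup F (rdiv_opp op)).
  { refine (distributive_soft_quasigroup_left_division _ hopp).
    intros x y z; exact (rdivP hq y x z). }
  pose proof (distributive_soft_quasigroup_opposite hldiv
                : distributive_soft_quasigroup F (ldiv_opp op)) as hldiv_opp.
  pose proof (distributive_soft_quasigroup_opposite hrdiv_opp
                : distributive_soft_quasigroup F (rdiv op)) as hrdiv.
  repeat match goal with |- _ /\ _ => split end;
    first [ apply distributive_soft_quasigroup_idempotent
          | apply distributive_soft_quasigroup_flexible
          | idtac ]; assumption.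
Qed.
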